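(* Let $\mathcal A$ be an infinite radially symmetric antitree with sphere numbers $\{s_n\}_{n\ge0}$ and edge lengths $\{\ell_n\}_{n\ge0}$. Its isoperimetric constant is $$\alpha(\mathcal A)=\inf_{n\ge0}\frac{s_ns_{n+1}}{\sum_{k=0}^ns_ks_{k+1}\ell_k}.$$
   Context: Radially symmetric antitree: let $s_0=1$, $s_n\in\mathbb Z_{\ge1}$ ($n\ge1$) and $\ell_n>0$ ($n\ge0$). The infinite radially symmetric (metric) antitree $\mathcal A$ with sphere numbers $\{s_n\}$ and edge lengths $\{\ell_n\}$ is the rooted metric graph whose vertex set $\mathcal V$ is the disjoint union of finite sets $S_n$, $\#S_n=s_n$ ($S_0=\{o\}$, $o$ the root), in which every vertex of $S_n$ is joined by exactly one edge to every vertex of $S_{n+1}$ for all $n\ge 0$, there are no other edges, and each edge joining $S_n$ with $S_{n+1}$ has length $\ell_n$. Isoperimetric constant of a metric graph $\mathcal G$: $$\alpha(\mathcal G):=\inf_{\widetilde{\mathcal G}}\frac{\deg_{\mathcal G}(\partial\widetilde{\mathcal G})}{\mathrm{vol}(\widetilde{\mathcal G})},$$ where the infimum is over all finite connected subgraphs $\widetilde{\mathcal G}=(\widetilde{\mathcal V},\widetilde{\mathcal E})$ of $\mathcal G$ (having at least one edge), $\partial\widetilde{\mathcal G}=\{v\in\widetilde{\mathcal V}:\deg_{\widetilde{\mathcal G}}(v)<\deg_{\mathcal G}(v)\}$, $\deg_{\mathcal G}(\partial\widetilde{\mathcal G}):=\sum_{v\in\partial\widetilde{\mathcal G}}\deg_{\widetilde{\mathcal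 G}}(v)$ (note: degrees in the subgraph), and $\mathrm{vol}(\widetilde{\mathcal G}):=\sum_{e\in\widetilde{\mathcal E}}|e|$ with $|e|$ the length of $e$. *)

(* Defs.v *)
From HB Require Import structures.
From mathcomp Require Import all_boot all_order all_algebra finmap.
From mathcomp Require Import all_classical all_reals ereal.

Set Implicit Arguments.
Unset Strict Implicit.
Unset Printing Implicit Defensive.

Import Order.TTheory GRing.Theory Num.Theory.

Local Open Scope fset_scope.
Local Open Scope classical_set_scope.
Local Open Scope ring_scope.

(* Locally finite metric graphs without loops or multiple edges: an edge is
   identified with the set of its two endpoints. *)
Record metricGraph (R : realType) := MetricGraph {
  vertex : choiceType;
  edge : set {fset vertex};
  edge_len : {fset vertex} -> R;
  edge_card2 : forall e, edge e -> #|` e| = 2%N;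
  edge_len_gt0 : forall e, edge e -> 0 < edge_len e;
  edge_locally_finite : forall v, finite_set [set e | edge e /\ v \in e]
}.

Definition deg (R : realType) (G : metricGraph R) (v : vertex G) : nat :=
  #|` fset_set [set e | edge e /\ v \in e] |.

Record finSubgraph (R : realType) (G : metricGraph R) := FinSubgraph {
  sub_vertex : {fset vertex G};
  sub_edge : {fset {fset vertex G}};
  sub_edgeP : forall e, e \in sub_edge -> edge e;
  sub_edge_ends : forall e, e \in sub_edge -> (e `<=` sub_vertex)%fset
}.

Section Subgraph.
Variables (R : realType) (G : metricGraph R) (H : finSubgraph G).

Definition sub_connected : Prop :=
  forall x y, x \in sub_vertex H -> y \in sub_vertex H ->
  exists2 p : seq (vertex G),
    path (fun a b => [fset a; b] \in sub_edge H) x p & last x p = y.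

Definition sub_deg (v : vertex G) : nat :=
  #|` [fset e in sub_edge H | v \in e] |.

Definition boundary : {fset vertex G} :=
  [fset v in sub_vertex H | (sub_deg v < deg v)%N].

(* Boundary vertices are weighted by their degree in H, not in G. *)
Definition deg_boundary : nat := (\sum_(v <- boundary) sub_deg v)%N.

Definition vol : R := \sum_(e <- sub_edge H) edge_len e.

End Subgraph.

Definition isoperimetric_constant (R : realType) (G : metricGraph R) : \bar R :=
  ereal_inf [set ((deg_boundary H)%:R / vol H)%:E
            | H in [set H : finSubgraph G |
                     sub_connected H /\ sub_edge H != fset0]].

Record is_antitree (R : realType) (s : nat -> nat) (l : nat -> R)
    (G : metricGraph R) (o : vertex G) (S : nat -> {fset vertex G}) : Prop :=
  IsAntitree {
  sphere_root : S 0%N = [fset o];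
  sphere_card : forall n, #|` S n| = s n;
  sphere_disjoint : forall m n, m != n -> [disjoint S m & S n]%fset;
  sphere_cover : forall v, exists n, v \in S n;
  antitree_edge : forall e, edge e <->
    exists n x y, [/\ x \in S n, y \in S n.+1 & e = [fset x; y]];
  antitree_len : forall n x y, x \in S n -> y \in S n.+1 ->
    edge_len [fset x; y] = l n
}.

Lemma antitree_exists (R : realType) (s : nat -> nat) (l : nat -> R)
  (s0 : s 0%N = 1%N) (l_gt0 : forall n, 0 < l n) :
  exists (A : metricGraph R) (o : vertex A) (S : nat -> {fset vertex A}),
    is_antitree s l o S.
Proof.
pose V : choiceType := {n : nat & 'I_(s n)}.
pose T n (i : 'I_(s n)) : V := existT _ n i.
have Tinj n : injective (@T n) by move=> i j /eqP; rewrite eq_Tagged => /eqP.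
pose S n : {fset V} := [fset @T n i | i in 'I_(s n)].
have inS n (v : V) : (v \in S n) = (tag v == n).
  apply/imfsetP/eqP => [[i _ ->] //|]; case: v => m i /= mn; subst m.
  by exists i.
pose P (e : {fset V}) n := exists x y,
  [/\ x \in S n, y \in S n.+1 & e = [fset x; y]].
have Pinj e m n : P e m -> P e n -> (m <= n)%N.
  move=> [x [y []]]; rewrite !inS => /eqP xm /eqP ym -> [x' [y' []]].
  rewrite !inS => /eqP xn /eqP yn /fsetP /(_ x'); rewrite !inE eqxx /=.
  by case/orP => /eqP h; move: xn; rewrite h ?xm ?ym => <-.
pose E : set {fset V} := [set e | exists n, P e n].
pose len (e : {fset V}) : R := l (xget 0%N (P e)).
have lenE n x y : x \in S n -> y \in S n.+1 -> len [fset x; y] = l n.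
  move=> xn yn; rewrite /len; congr l.
  have Pn : P [fset x; y] n by exists x, y.
  case: xgetP => [m _ Pm|/(_ n)]; last by [].
  by apply/eqP; rewrite eqn_leq (Pinj _ _ _ Pm Pn) (Pinj _ _ _ Pn Pm).
have E2 e : E e -> #|` e| = 2%N.
  move=> [n [x [y [xn yn ->]]]]; rewrite cardfs2; case: eqP => // h.
  by move: xn yn; rewrite !inS h => /eqP -> /eqP /n_Sn.
have Ef v : finite_set [set e | E e /\ v \in e].
  apply: (@sub_finite_set _ _
    [set` fpowerset (S (tag v).-1 `|` S (tag v) `|` S (tag v).+1)%fset]); last exact: finite_fset.
  move=> e /= [[n [x [y [xn yn ->]]]] /fset2P v_].
  rewrite fpowersetE; apply/fsubsetP => z /fset2P z_.
  move: xn yn; rewrite !inE !inS => /eqP xn /eqP yn.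
  by case: v_ => ->; case: z_ => ->; rewrite ?xn ?yn /= ?eqxx ?orbT.
have Ep e : E e -> 0 < len e by move=> _; exact: l_gt0.
have i0 : 'I_(s 0) by rewrite s0; exact: ord0.
have i0E (i : 'I_(s 0)) : i = i0.
  by apply: val_inj; case: i i0 => [a ha] [b hb] /=; move: ha hb;
  rewrite s0 !ltnS !leqn0 => /eqP -> /eqP ->.
exists (MetricGraph E2 Ep Ef), (@T 0%N i0), S; split => //=.
- apply/fsetP => v; rewrite inS !inE; apply/eqP/eqP => [|-> //].
  case: v => m i /= m0; subst m; by rewrite (i0E i).
- by move=> n; rewrite (card_imfset _ _ (@Tinj n)) /= -cardE card_ord.
- move=> m n mn; apply/fdisjointP => v; by rewrite !inS => /eqP ->.
- by move=> v; exists (tag v); rewrite inS.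
Qed.

(* Main.v *)
(* For a finite subgraph [H], let [t n] be the proportion of the edges between
   [S n] and [S n.+1] that lie in [H], and [D n] the boundary degree of [H]
   carried by [S n.+1].  A vertex of [S n.+1] off the boundary has in [H] either
   no edge or all of its edges, so that [t n <= D n / (s n * s n.+1) + t n.+1].
   If [a] is a lower bound of the ratios attained by balls, summing this by
   parts against the volumes of the layers gives [a * vol H <= deg_boundary H].
   The converse inequality is attained by the balls themselves, whose boundary
   lies in their outermost sphere. *)
Require Import Defs.
From mathcomp Require Import all_boot all_order all_algebra finmap.
From mathcomp Require Import all_classical all_reals ereal.
From mathcomp Require Import zify ring lra.

Set Implicit Arguments.
Unset Strict Implicit.
Unset Printing Implicit Defensive.

Import Order.TTheory GRing.Theory Num.Theory.
Local Open Scope classical_set_scope.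
Local Open Scope ring_scope.

(** * Finite sums and summation by parts *)

Lemma big_seq_only1 (V : nmodType) (I : eqType) (r : seq I) (i : I)
    (F : I -> V) : uniq r -> i \in r ->
  (forall j, j \in r -> j != i -> F j = 0) -> \sum_(j <- r) F j = F i.
Proof.
move=> ur ir F0; rewrite (bigD1_seq i)//= big1_seq ?addr0// => j /andP[ji jr].
exact: F0.
Qed.

(** Summation by parts, by induction on [n]. The last term is the volume accumulated so far times
    the current [t n]; passing to [t n.+1] costs at most [D n], because the bound on partial sums
    makes the coefficient of [D n / w n] at most [w n]. *)
Lemma weighted_sum_le (R : realType) (a : R) (w l t D : nat -> R) (n : nat) :
  0 <= a -> (forall k, 0 <= w k) -> (forall k, 0 <= l k) ->
  (forall k, 0 <= D k) ->
  (forall k, a * \sum_(0 <= j < k.+1) w j * l j <= w k) ->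
  (forall k, t k <= D k / w k + t k.+1) ->
  a * \sum_(0 <= k < n) w k * t k * l k <=
  \sum_(0 <= k < n) D k + a * (\sum_(0 <= k < n) w k * l k) * t n.
Proof.
move=> a0 w0 l0 D0 aw tD; elim: n => [|n IH].
  by rewrite !big_geq// !mulr0 mul0r addr0.
move: (aw n) (tD n); rewrite !big_nat_recr//=.
move: IH; set L := \sum_(0 <= k < n) w k * l k.
set X := \sum_(0 <= k < n) _; set Y := \sum_(0 <= k < n) _ => IH awn tDn.
have L0 : 0 <= L by apply: sumr_ge0 => k _; rewrite mulr_ge0.
pose c := a * (L + w n * l n).
have c0 : 0 <= c by rewrite mulr_ge0// addr_ge0// mulr_ge0.
have cD : c * (D n / w n) <= D n.
  (* If [w n] is zero, so is its inverse by convention, and [D n >= 0] suffices; otherwise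
     [c <= w n]. *)
  have [wn0|wn0] := eqVneq (w n) 0.
    by rewrite wn0 invr0 !mulr0.
  by rewrite mulrCA ler_piMr// ler_pdivrMr ?mul1r// lt_neqAle eq_sym wn0 w0.
have ct : c * t n <= c * (D n / w n) + c * t n.+1.
  by rewrite -mulrDr ler_wpM2l.
apply: (@le_trans _ _ (Y + c * t n)); last by rewrite /c in cD ct *; lra.
by rewrite /c; move: IH; lra.
Qed.

(** * Spheres and edges of an antitree *)

Section Antitree.
Variables (R : realType) (s : nat -> nat) (l : nat -> R).
Variables (A : metricGraph R) (o : vertex A) (S : nat -> {fset vertex A}).
Hypothesis hA : is_antitree s l o S.

Lemma sphere_inj v m n : v \in S m -> v \in S n -> m = n.
Proof.
move=> vm vn; apply/eqP; apply: contraT => /(sphere_disjoint hA)/fdisjointP.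
by move=> /(_ _ vm); rewrite vn.
Qed.

(** The endpoints of an edge lie in consecutive spheres, so the sphere index orients it. Matching
    [x] with [y'] would force [m = n.+1], and then [x'] could be neither [x] nor [y]. *)
Lemma antitree_edge_inj m n x y x' y' :
  x \in S m -> y \in S m.+1 -> x' \in S n -> y' \in S n.+1 ->
  [fset x; y]%fset = [fset x'; y']%fset -> [/\ m = n, x = x' & y = y'].
Proof.
move=> xm ym xn yn /fsetP E.
have xE : x \in [fset x'; y']%fset by rewrite -E !inE eqxx.
have yE : y \in [fset x'; y']%fset by rewrite -E !inE eqxx orbT.
have x'E : x' \in [fset x; y]%fset by rewrite E !inE eqxx.
case/fset2P: xE => ?; subst x; have mn := sphere_inj xm; last first.
  by have := mn _ yn; case/fset2P: x'E => ?; subst x';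
     [have := mn _ xn | have := sphere_inj ym xn]; lia.
have := mn _ xn; case/fset2P: yE => ?; subst y => //.
by have := mn _ ym; lia.
Qed.

Lemma edge_neighbour n v e : v \in S n.+1 -> edge e -> v \in e ->
  (exists2 x, x \in S n & e = [fset x; v]%fset) \/
  (exists2 z, z \in S n.+2 & e = [fset v; z]%fset).
Proof.
move=> vn /(antitree_edge hA)[m [x [y [xm ym ->]]]] /fset2P[] ?; subst v.
  by right; exists y; rewrite // -(sphere_inj xm vn).
by left; exists x => //; have [<-] := sphere_inj ym vn.
Qed.

(** * Finite subgraphs, layer by layer *)

Section Subgraph.
Variable H : finSubgraph A.

Definition adj (x y : vertex A) : bool := [fset x; y]%fset \in sub_edge H.

Definition layer_size (n : nat) : nat :=
  (\sum_(y <- S n.+1) \sum_(x <- S n) adj x y)%N.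

Lemma adj_subr x y : adj x y -> y \in sub_vertex H.
Proof. by move/sub_edge_ends/fsubsetP; apply; rewrite !inE eqxx orbT. Qed.

(** Sending [x] to the edge from [x] to [y] embeds the neighbours of [y] in [S n] along [H] into the
    edges of [H] at [y]. *)
Lemma sum_adj_le_sub_deg n y : y \in S n.+1 ->
  (\sum_(x <- S n) adj x y <= sub_deg H y)%N.
Proof.
move=> yn; rewrite -big_mkcond sum1_count -size_filter.
rewrite -(size_map (fun x => [fset x; y]%fset)).
apply: uniq_leq_size => [|e /mapP[x]]; last first.
  by rewrite mem_filter => /andP[xy _] ->; rewrite !inE eqxx orbT andbT.
rewrite map_inj_in_uniq ?filter_uniq// => x x'.
rewrite !mem_filter => /andP[_ xn] /andP[_ x'n].
by case/(antitree_edge_inj xn yn x'n yn).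
Qed.

(** The edges of [H] at [v] are among those of the antitree at [v]; comparing finite cardinalities
    makes the two sets coincide. *)
Lemma full_degree_adj v e : (deg v <= sub_deg H v)%N -> edge e -> v \in e ->
  e \in sub_edge H.
Proof.
move=> dv ee ve.
have fG := @edge_locally_finite _ A v.
have sub : ([fset e in sub_edge H | v \in e] `<=`
            fset_set [set e | edge e /\ v \in e])%fset.
  apply/fsubsetP => f; rewrite !inE in_fset_set// => /andP[fH vf].
  by apply/mem_set; exact: (conj (sub_edgeP fH) vf).
have /eqP E : [fset e in sub_edge H | v \in e]%fset ==
            fset_set [set e | edge e /\ v \in e] by rewrite eqEfcard sub.
have : e \in fset_set [set e | edge e /\ v \in e].
  by rewrite in_fset_set//; apply/mem_set.
by rewrite -E !inE => /andP[].
Qed.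

(* A vertex off the boundary either has no edge in [H] or is joined in [H] to
   all of its neighbours. *)
Lemma down_degree_le n y : y \in S n.+1 ->
  ((\sum_(x <- S n) adj x y) * s n.+2 <=
   (y \in boundary H) * sub_deg H y * s n.+2
   + (\sum_(z <- S n.+2) adj y z) * s n)%N.
Proof.
move=> yn; have [yb|yb] := boolP (y \in boundary H).
  rewrite mul1n (leq_trans _ (leq_addr _ _))// leq_mul2r.
  by rewrite sum_adj_le_sub_deg ?orbT.
rewrite !mul0n add0n.
have [yH|yH] := boolP (y \in sub_vertex H); last first.
  by rewrite big1// => x _; case: (boolP (adj x y)) => // /adj_subr; rewrite (negPf yH).
have dy : (deg y <= sub_deg H y)%N.
  by move: yb; rewrite !inE yH /= -leqNgt.
rewrite [X in (_ <= X * _)%N]big_seq [X in (_ <= X * _)%N](eq_bigr (fun _ => 1%N)).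
  rewrite -big_seq sum1_size (sphere_card hA) mulnC leq_mul2l.
  rewrite -(sphere_card hA n) -sum1_size leq_sum ?orbT// => x _.
  by case: adj.
move=> z zn; rewrite /adj (full_degree_adj (v := y))//; last by rewrite !inE eqxx.
by apply/(antitree_edge hA); exists n.+1, y, z.
Qed.

Definition boundary_layer (n : nat) : nat :=
  (\sum_(y <- boundary H | y \in S n.+1) sub_deg H y)%N.

(** This is [down_degree_le] summed over [S n.+1], the edges to [S n.+2] being counted from their
    lower endpoint. Dividing by [s n * s n.+1 * s n.+2] gives the recursion for [t]. *)
Lemma layer_size_step n :
  (layer_size n * s n.+2 <=
   boundary_layer n * s n.+2 + layer_size n.+1 * s n)%N.
Proof.
have -> : boundary_layer n =
    (\sum_(y <- S n.+1) (y \in boundary H) * sub_deg H y)%N.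
  under [RHS]eq_bigr do rewrite mulnbl.
  rewrite -big_mkcond /boundary_layer -big_filter -[RHS]big_filter.
  apply: perm_big; apply: uniq_perm; rewrite ?filter_uniq// => y.
  by rewrite !mem_filter andbC.
rewrite [layer_size n.+1]exchange_big /layer_size /= !big_distrl -big_split /=.
rewrite big_seq [X in (_ <= X)%N]big_seq.
by apply: leq_sum => y; exact: down_degree_le.
Qed.

(** Spheres are disjoint, so a boundary vertex is counted at most once. The root and the spheres
    beyond [S N] are left out, hence an inequality. *)
Lemma sum_boundary_layer_le N :
  (\sum_(0 <= n < N) boundary_layer n <= deg_boundary H)%N.
Proof.
rewrite /boundary_layer; under eq_bigr do rewrite big_mkcond /=.
rewrite exchange_big /=; apply: leq_sum => y _.
have [m ym] := sphere_cover hA y.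
have [mN|mN] := boolP ((0 < m)%N && (m.-1 < N)%N); last first.
  rewrite big_nat big1// => n nN; case: ifP => // yn; case/negP: mN.
  by rewrite (sphere_inj ym yn).
rewrite (big_seq_only1 (i := m.-1)) ?iota_uniq ?mem_index_iota//; first by case: ifP.
  by case/andP: mN.
move=> n _ nm; case: ifP => // yn; move: nm; rewrite (sphere_inj ym yn).
by rewrite eqxx.
Qed.

(** Double counting: each layer is expanded into indicators over [sub_edge H], and after exchanging
    the sums every edge matches exactly one choice of layer and endpoints. Vertices up to [S N] only
    give layers below [N]. *)
Lemma volE N :
  (forall v, v \in sub_vertex H -> exists2 n, (n <= N)%N & v \in S n) ->
  vol H = \sum_(0 <= n < N) (layer_size n)%:R * l n.
Proof.
move=> HN; rewrite /vol.
have lE n : (layer_size n)%:R * l n =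
    \sum_(e <- sub_edge H) \sum_(y <- S n.+1) \sum_(x <- S n)
      (e == [fset x; y]%fset)%:R * l n.
  rewrite exchange_big natr_sum big_distrl /=; apply: eq_bigr => y _.
  rewrite exchange_big natr_sum big_distrl /=; apply: eq_bigr => x _.
  rewrite -big_distrl /=; congr (_ * _).
  rewrite -natr_sum; congr (_%:R).
  by rewrite -big_mkcond sum1_count -count_uniq_mem ?fset_uniq.
rewrite (eq_bigr _ (fun n _ => lE n)) exchange_big /=.
apply: eq_big_seq => e eH.
have /(antitree_edge hA)[n [x [y [xn yn eE]]]] := sub_edgeP eH.
have nN : (n < N)%N.
  have [|m mN ym] := HN y; last by rewrite (sphere_inj yn ym).
  by apply: (@adj_subr x); rewrite /adj -eE.
rewrite (big_seq_only1 (i := n)) ?iota_uniq ?mem_index_iota//; last first.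
  move=> m _ mn; rewrite big1_seq// => y' /= y'm; rewrite big1_seq// => x' /= x'm.
  case: eqP => [|]; last by rewrite mul0r.
  rewrite eE => /(antitree_edge_inj xn yn x'm y'm)[nm].
  by rewrite nm eqxx in mn.
rewrite (big_seq_only1 (i := y))//; last first.
  move=> y' y'm mn; rewrite big1_seq// => x' /= x'm.
  case: eqP => [|]; last by rewrite mul0r.
  rewrite eE => /(antitree_edge_inj xn yn x'm y'm)[_ _ yy].
  by rewrite yy eqxx in mn.
rewrite (big_seq_only1 (i := x))//; last first.
  move=> x' x'm mn.
  case: eqP => [|]; last by rewrite mul0r.
  rewrite eE => /(antitree_edge_inj xn yn x'm yn)[_ xx].
  by rewrite xx eqxx in mn.
by rewrite eE eqxx mul1r (antitree_len hA xn yn).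
Qed.

Lemma sub_vertex_bounded : exists N, forall v, v \in sub_vertex H ->
  exists2 n, (n <= N)%N & v \in S n.
Proof.
have [f fP] := choice (sphere_cover hA).
exists (\max_(v <- sub_vertex H) f v)%N => v vH; exists (f v) => //.
exact: (@leq_bigmax_seq _ (enum_fset _) xpredT f v vH).
Qed.

(** Here [a] is a lower bound of the ball ratios with denominators cleared; [weighted_sum_le] is
    applied with the full layer sizes [s n * s n.+1] as weights. *)
Lemma deg_boundary_ge (a : R) : (forall n, (1 <= s n)%N) ->
  (forall n, 0 < l n) -> 0 <= a ->
  (forall n, a * \sum_(0 <= k < n.+1) (s k * s k.+1)%:R * l k <=
             (s n * s n.+1)%:R) ->
  a * vol H <= (deg_boundary H)%:R.
Proof.
move=> s_ge1 l_gt0 a0 aw.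
have s_neq0 n : (s n)%:R != 0 :> R by rewrite pnatr_eq0 -lt0n.
have [N HN] := sub_vertex_bounded.
pose t n : R := (layer_size n)%:R / (s n * s n.+1)%:R.
(* No vertex of [H] lies in [S N.+1], so the leftover term of the summation vanishes. *)
have tN : t N = 0.
  rewrite /t /layer_size big1_seq ?mul0r// => y /= yN; rewrite big1// => x _.
  case: (boolP (adj x y)) => // /adj_subr /HN[n nN yn].
  by have := sphere_inj yn yN; lia.
have tD n : t n <= (boundary_layer n)%:R / (s n * s n.+1)%:R + t n.+1.
  have := layer_size_step n; rewrite -(ler_nat R) natrD !natrM => h.
  rewrite /t !natrM -(@ler_pM2r _ ((s n)%:R * (s n.+1)%:R * (s n.+2)%:R)).
    have -> : (layer_size n)%:R / ((s n)%:R * (s n.+1)%:R) *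
        ((s n)%:R * (s n.+1)%:R * (s n.+2)%:R) =
        (layer_size n)%:R * (s n.+2)%:R :> R by field; rewrite !s_neq0.
    apply: (le_trans h); rewrite le_eqVlt; apply/orP; left; apply/eqP.
    by field; rewrite !s_neq0.
  by rewrite !mulr_gt0// lt0r s_neq0 ler0n.
have := @weighted_sum_le _ a (fun n => (s n * s n.+1)%:R) l t
  (fun n => (boundary_layer n)%:R) N a0 (fun=> ler0n _ _)
  (fun k => ltW (l_gt0 k)) (fun=> ler0n _ _) aw tD.
rewrite tN mulr0 addr0 => h.
rewrite (volE HN); apply: le_trans (le_trans h _).
  rewrite ler_wpM2l// ler_sum// => k _; rewrite /t mulrCA divff ?mulr1//.
  by rewrite natrM mulf_neq0.
by rewrite -natr_sum ler_nat sum_boundary_layer_le.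
Qed.

Lemma vol_gt0 : sub_edge H != fset0 -> 0 < vol H.
Proof.
case/fset0Pn => e eH; rewrite /vol (big_fsetD1 e)//= ltr_wpDr//.
  rewrite big_seq; apply: sumr_ge0 => f; rewrite !inE => /andP[_ fH].
  exact/ltW/edge_len_gt0/(sub_edgeP fH).
exact/edge_len_gt0/(sub_edgeP eH).
Qed.

End Subgraph.

(** * Balls around the root *)

Section Ball.
Variable n : nat.

(** The ball reaches up to [S n.+1], so that its layers [0] to [n] are exactly those in the
    denominator of the [n]-th ratio. *)
Definition ball_vertex : {fset vertex A} := (\bigcup_(k <- iota 0 n.+2) S k)%fset.

Definition ball_edge : {fset {fset vertex A}} :=
  (\bigcup_(k <- iota 0 n.+1)
    [fset [fset x; y]%fset | x in S k, y in S k.+1])%fset.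

Lemma ball_vertexP v : reflect (exists2 k, (k < n.+2)%N & v \in S k)
  (v \in ball_vertex).
Proof.
apply: (iffP (bigfcupP _ _ _ _)) => -[k].
  by rewrite andbT mem_iota => kn vk; exists k.
by move=> kn vk; exists k; rewrite // andbT mem_iota.
Qed.

Lemma ball_edgeP e : reflect
  (exists k x y, [/\ (k < n.+1)%N, x \in S k, y \in S k.+1 &
                     e = [fset x; y]%fset])
  (e \in ball_edge).
Proof.
apply: (iffP (bigfcupP _ _ _ _)) => [[k]|[k [x [y [kn xk yk ->]]]]].
  rewrite andbT mem_iota => kn /imfset2P[x xk [y yk ->]].
  by exists k, x, y.
by exists k; [rewrite andbT mem_iota|apply/imfset2P; exists x => //; exists y].
Qed.

Lemma ball_edge_edge e : e \in ball_edge -> edge e.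
Proof.
case/ball_edgeP => k [x [y [_ xk yk ->]]].
by apply/(antitree_edge hA); exists k, x, y.
Qed.

Lemma ball_edge_ends e : e \in ball_edge -> (e `<=` ball_vertex)%fset.
Proof.
case/ball_edgeP => k [x [y [kn xk yk ->]]]; apply/fsubsetP => z /fset2P[] ->.
  by apply/ball_vertexP; exists k => //; lia.
by apply/ball_vertexP; exists k.+1.
Qed.

Definition ball : finSubgraph A := FinSubgraph ball_edge_edge ball_edge_ends.

(** Each vertex is joined to the root by descending through the nonempty spheres. The induction
    carries both directions, so that any two vertices connect through [o]. *)
Lemma ball_connected : (forall n, (1 <= s n)%N) -> sub_connected ball.
Proof.
move=> s_ge1; pose r (a b : vertex A) := [fset a; b]%fset \in ball_edge.
pose conn x y := exists2 p : seq (vertex A), path r x p & last x p = y.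
have connT x y z : conn x y -> conn y z -> conn x z.
  move=> [p px py] [q qx qy]; exists (p ++ q); last by rewrite last_cat py.
  by rewrite cat_path px py.
have conn1 x y : r x y -> conn x y by move=> xy; exists [:: y]; rewrite //= xy.
have to_root k v : (k < n.+2)%N -> v \in S k -> conn v o /\ conn o v.
  elim: k v => [|k IH] v kn.
    by rewrite (sphere_root hA) inE => /eqP ->; split; exists [::].
  move=> vk; have /fset0Pn[x xk] : S k != fset0.
    by rewrite -cardfs_gt0 (sphere_card hA).
  have [xo ox] := IH x (ltnW kn) xk.
  have xv : r x v by apply/ball_edgeP; exists k, x, v.
  split; first by apply: connT xo; apply: conn1; rewrite /r fsetUC.
  by apply: (connT _ _ _ ox); exact: conn1.
move=> x y /ball_vertexP[i ik xi] /ball_vertexP[j jk yj].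
by apply: (connT _ o); [case: (to_root i x)|case: (to_root j y)].
Qed.

Lemma ball_edge_neq0 : (forall n, (1 <= s n)%N) -> sub_edge ball != fset0.
Proof.
move=> s_ge1; have ne k : S k != fset0 by rewrite -cardfs_gt0 (sphere_card hA).
have /fset0Pn[x x0] := ne 0%N; have /fset0Pn[y y1] := ne 1%N.
by apply/fset0Pn; exists [fset x; y]%fset; apply/ball_edgeP; exists 0%N, x, y.
Qed.

(** Below the outermost sphere the ball contains every adjacent layer, so no edge is missing
    there. *)
Lemma boundary_ball v : v \in boundary ball -> v \in S n.+1.
Proof.
rewrite !inE => /andP[/ball_vertexP[k kn vk]]; apply: contraTT => vn.
have {}kn : (k < n.+1)%N.
  by rewrite ltn_neqAle -ltnS kn andbT; apply: contraNneq vn => <-.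
rewrite -leqNgt /deg fsubset_leq_card//; apply/fsubsetP => e.
rewrite in_fset_set ?inE; last exact: edge_locally_finite.
move=> [/(antitree_edge hA)[m [x [y [xm ym ->]]]] ve].
rewrite ve andbT; apply/ball_edgeP; exists m, x, y; split => //.
case/fset2P: ve => ?; subst v; first by rewrite (sphere_inj xm vk).
by have := sphere_inj ym vk; lia.
Qed.

(** The layer above [S n.+1] is absent from the ball, so every edge of the ball at [v] leads down to
    [S n]. *)
Lemma sub_deg_ball v : v \in S n.+1 -> (sub_deg ball v <= s n)%N.
Proof.
move=> vn; rewrite -(sphere_card hA).
apply: (@leq_trans #|` [fset [fset x; v]%fset | x in S n]%fset|); last first.
  exact: leq_imfset_card.
apply: fsubset_leq_card; apply/fsubsetP => e; rewrite !inE => /andP[].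
case/ball_edgeP => k [x [y [kn xk yk ->]]] /fset2P[] ?; subst v.
  by have := sphere_inj xk vn; lia.
apply/imfsetP; exists x => //=.
by have [<-] := sphere_inj yk vn.
Qed.

Lemma deg_boundary_ball : (deg_boundary ball <= s n * s n.+1)%N.
Proof.
rewrite mulnC -(sphere_card hA n.+1) -sum1_size big_distrl /=.
apply: (@leq_trans (\sum_(v <- boundary ball) s n)%N).
  rewrite /deg_boundary big_seq [X in (_ <= X)%N]big_seq.
  by apply: leq_sum => v /boundary_ball; exact: sub_deg_ball.
under [X in (_ <= X)%N]eq_bigr do rewrite mul1n.
rewrite !big_const_seq !count_predT !iter_addn_0 leq_mul2l.
by rewrite fsubset_leq_card ?orbT//; apply/fsubsetP => v /boundary_ball.
Qed.

(** All pairs from consecutive spheres of the ball are adjacent, so its layers are full. *)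
Lemma vol_ball : vol ball = \sum_(0 <= k < n.+1) (s k * s k.+1)%:R * l k.
Proof.
rewrite (volE (N := n.+1)) => [|v /ball_vertexP[k kn vk]]; last by exists k.
rewrite big_nat [RHS]big_nat; apply: eq_bigr => k kn; congr (_%:R * _).
rewrite /layer_size -!(sphere_card hA) mulnC.
rewrite -[X in _ = (X * _)%N]sum1_size big_distrl /=; apply: eq_big_seq => y yk.
rewrite mul1n -sum1_size; apply: eq_big_seq => x xk.
have -> // : adj ball x y.
by apply/ball_edgeP; exists k, x, y.
Qed.

End Ball.
End Antitree.

(** * Equality of the two infima *)

Theorem theorem7p1 (R : realType) (s : nat -> nat) (l : nat -> R)
  (s0 : s 0%N = 1%N) (s_ge1 : forall n, (1 <= s n)%N)
  (l_gt0 : forall n, 0 < l n)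
  (A : metricGraph R) (o : vertex A) (S : nat -> {fset vertex A})
  (hA : is_antitree s l o S) :
  isoperimetric_constant A =
  ereal_inf [set ((s n * s n.+1)%:R /
                  \sum_(0 <= k < n.+1) (s k * s k.+1)%:R * l k)%:E | n in setT].
Proof.
set T := [set _ | n in setT].
have vol0 n : 0 < \sum_(0 <= k < n.+1) (s k * s k.+1)%:R * l k.
  rewrite -(vol_ball hA); apply: vol_gt0; exact: ball_edge_neq0.
apply/eqP; rewrite eq_le; apply/andP; split; apply/ereal_infP.
  (* The balls are admissible, and the ratio of [ball hA n] is at most the [n]-th one. *)
  move=> _ [n _ <-]; apply: ge_ereal_inf.
  exists ((deg_boundary (ball hA n))%:R / vol (ball hA n))%:E.
    exists (ball hA n) => //; split; first exact: ball_connected.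
    exact: ball_edge_neq0.
  by rewrite (vol_ball hA) lee_fin ler_pM2r ?invr_gt0// ler_nat deg_boundary_ball.
move=> _ [H [_ H0] <-].
have inf0 : (0 <= ereal_inf T)%E.
  apply/ereal_infP => _ [n _ <-].
  by rewrite lee_fin divr_ge0 ?ler0n// ltW.
have inf_le n : (ereal_inf T <= ((s n * s n.+1)%:R /
    \sum_(0 <= k < n.+1) (s k * s k.+1)%:R * l k)%:E)%E.
  by apply: ereal_inf_lbound; exists n.
(* Nonnegativity excludes minus infinity and the ratio at [0] excludes plus infinity, so the infimum
   is a real [a] to which [deg_boundary_ge] applies. *)
case: (ereal_inf T) inf0 inf_le => [a||] //; last by move=> _ /(_ 0%N).
rewrite lee_fin => a0 a_le; rewrite lee_fin ler_pdivlMr ?vol_gt0//.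
apply: (deg_boundary_ge hA) => // n.
by have := a_le n; rewrite lee_fin ler_pdivlMr.
Qed.
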